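(* Let $(B,+,\circ)$ be a left $RG$-semibrace. Then the map $r_B:B\times B\to B\times B$ defined by $r_B(a,b)=(\lambda_a(b),\rho_b(a))$, for all $a,b\in B$, is a left non-degenerate set-theoretic solution of the Yang--Baxter equation.
   Context: A right group is a non-empty semigroup $(S,\cdot)$ such that for all $a,b\in S$ there is a unique $x\in S$ with $a\cdot x=b$. A left $RG$-semibrace is a triplet $(B,+,\circ)$ where $+,\circ$ are binary operations on the set $B$ such that $(B,+)$ and $(B,\circ)$ are both right groups and $a\circ(b+c)=a\circ b+(-a+a\circ c)$ for all $a,b,c\in B$, where $-a+a\circ c$ denotes the unique $x\in B$ such that $a+x=a\circ c$. Fix an idempotent $0$ of $(B,\circ)$ (it is then also idempotent in $(B,+)$). The set $G=B+0=\{b+0\mid b\in B\}$ is a subgroup of $(B,+)$ with identity $0$; put $g_b=b+0\in G$, and let $-g_b$ be its inverse in $(G,+)$. The set $H=B\circ 0=\{b\circ 0\mid b\in B\}$ is a subgroup of $(B,\circ)$ with identity $0$; put $h_b=b\circ 0\in H$, and let $h_b^-$ be its inverse in $(H,\circ)$. For $a,b\in B$ put $\lambda_a(b)=-g_a+a\circ b$ (equivalently, the unique $x\in B$ with $a+x=a\circ b$) and $\rho_b(a)=h^-_{\lambda_a(b)}\circ a\circ b$. For a set $X$, a map $r:X\times X\to X\times X$ is a (set-theoretic) solution of the Yang--Baxter equation if $(r\times \mathrm{id}_X)(\mathrm{id}_X\times r)(r\times \mathrm{id}_X)=(\mathrm{id}_X\times r)(r\times \mathrm{id}_X)(\mathrm{id}_X\times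 r)$. Writing $r(x,y)=(\lambda_x(y),\rho_y(x))$, the solution is left non-degenerate if $\lambda_x:X\to X$ is bijective for every $x\in X$. *)

(* Defs.v *)
From mathcomp Require Import all_boot.
From Stdlib Require Import ClassicalEpsilon.

Set Implicit Arguments.
Unset Strict Implicit.
Unset Printing Implicit Defensive.

Record is_right_group (S : Type) (op : S -> S -> S) : Prop := IsRightGroup {
  right_group_nonempty : inhabited S;
  right_group_assoc : associative op;
  right_group_solve : forall a b : S, exists! x : S, op a x = b }.

(* The unique solution x of [op a x = b] when (S, op) is a right group, the
   element that is written -a + b in additive notation. *)
Definition right_solution (S : Type) (op : S -> S -> S) (a b : S) : S :=
  epsilon (inhabits b) (fun x => op a x = b).

Record is_left_RG_semibrace (B : Type) (add circ : B -> B -> B) : Prop :=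
  IsLeftRGSemibrace {
    semibrace_add : is_right_group add;
    semibrace_circ : is_right_group circ;
    semibrace_distr : forall a b c : B,
      circ a (add b c) =
        add (circ a b) (right_solution add a (circ a c)) }.

(* The set {op b e | b in S}; for e idempotent in a right group it is a group
   with identity e (lemmas [right_translate_*] below). *)
Definition right_translate (S : Type) (op : S -> S -> S) (e : S) : S -> Prop :=
  fun x => exists b : S, x = op b e.

(* Inverse of x in the group [right_translate op e]; the value is meaningful
   only for x in that group (see [subgroup_invP]). *)
Definition subgroup_inv (S : Type) (op : S -> S -> S) (e x : S) : S :=
  epsilon (inhabits e)
    (fun y => [/\ right_translate op e y, op x y = e & op y x = e]).

Section LambdaRho.

Variables (B : Type) (add circ : B -> B -> B) (zero : B).

Definition g_elt (b : B) : B := add b zero.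

Definition h_elt (b : B) : B := circ b zero.

Definition lambda (a b : B) : B :=
  add (subgroup_inv add zero (g_elt a)) (circ a b).

(* [rho b a] is rho_b(a): the index comes first. *)
Definition rho (b a : B) : B :=
  circ (circ (subgroup_inv circ zero (h_elt (lambda a b))) a) b.

Definition r_map (p : B * B) : B * B := (lambda p.1 p.2, rho p.2 p.1).

End LambdaRho.

Section YangBaxter.

Variables (X : Type) (r : X * X -> X * X).

Definition r_times_id (p : X * X * X) : X * X * X := (r p.1, p.2).

(* X * X * X associates to the left, hence the regrouping. *)
Definition id_times_r (p : X * X * X) : X * X * X :=
  (p.1.1, (r (p.1.2, p.2)).1, (r (p.1.2, p.2)).2).

Definition is_YBE_solution : Prop :=
  r_times_id \o id_times_r \o r_times_id =1
    id_times_r \o r_times_id \o id_times_r.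

Definition left_nondegenerate : Prop :=
  forall x : X, bijective (fun y : X => (r (x, y)).1).

End YangBaxter.

Section RightGroupFacts.

Variables (S : Type) (op : S -> S -> S) (rgS : is_right_group op).

Lemma right_solutionP a b : op a (right_solution op a b) = b.
Proof.
apply: (epsilon_spec (inhabits b) (fun x => op a x = b)).
by have [x [ax _]] := right_group_solve rgS a b; exists x.
Qed.

Lemma right_group_inj a : injective (op a).
Proof.
move=> x y exy; have [z [_ uz]] := right_group_solve rgS a (op a y).
by rewrite -(uz x exy) -(uz y erefl).
Qed.

Variables (e : S) (ee : op e e = e).

Lemma idem_left_id : left_id e op.
Proof.
by move=> x; apply: (@right_group_inj e); rewrite (right_group_assoc rgS) ee.
Qed.

Lemma right_translate_op x y :
  right_translate op e x -> right_translate op e y ->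
  right_translate op e (op x y).
Proof.
move=> _ [b ->]; exists (op x b); exact: right_group_assoc rgS _ _ _.
Qed.

Lemma right_translate_id : right_translate op e e.
Proof. by exists e. Qed.

Lemma right_translate_right_id x : right_translate op e x -> op x e = x.
Proof. by case=> b ->; rewrite -(right_group_assoc rgS) ee. Qed.

Lemma subgroup_invP x : right_translate op e x ->
  [/\ right_translate op e (subgroup_inv op e x),
      op x (subgroup_inv op e x) = e & op (subgroup_inv op e x) x = e].
Proof.
move=> Gx; apply: (epsilon_spec (inhabits e) (fun y =>
  [/\ right_translate op e y, op x y = e & op y x = e])).
have opA := right_group_assoc rgS.
have [y [xy _]] := right_group_solve rgS x e.
exists (op y e); split; first by exists y.
- by rewrite opA xy.
- apply: (@right_group_inj x).
  by rewrite -opA idem_left_id opA xy idem_left_id right_translate_right_id.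
Qed.

End RightGroupFacts.

Section SemibraceFacts.

Variables (B : Type) (add circ : B -> B -> B) (zero : B).
Hypothesis sbB : is_left_RG_semibrace add circ.
Hypothesis zero_idem : circ zero zero = zero.

Let rgA := semibrace_add sbB.
Let rgC := semibrace_circ sbB.

Lemma semibrace_add_left_id : left_id zero add.
Proof.
have idl := idem_left_id rgC zero_idem.
have neg0 c : right_solution add zero (right_solution add zero c) =
              right_solution add zero c.
  have := semibrace_distr sbB zero zero (right_solution add zero c).
  rewrite !idl (right_solutionP rgA) => E; apply: (right_group_inj rgA (a := zero)).
  by rewrite -E (right_solutionP rgA).
by move=> x; rewrite -{1}(right_solutionP rgA zero x) -neg0 !(right_solutionP rgA).
Qed.

Lemma semibrace_add_idem : add zero zero = zero.
Proof. exact: semibrace_add_left_id. Qed.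

Lemma lambdaP a b : add a (lambda add circ zero a b) = circ a b.
Proof.
have Ga : right_translate add zero (g_elt add zero a) by exists a.
have [_ aV _] := subgroup_invP rgA semibrace_add_idem Ga.
rewrite /lambda -[X in add a X]semibrace_add_left_id.
by rewrite !(right_group_assoc rgA) aV semibrace_add_left_id.
Qed.

End SemibraceFacts.

(* Main.v *)
Require Import Defs.
From mathcomp Require Import all_boot.

(** Everything rests on two factorizations of the same product,
    [a o b = a + lambda_a(b)] and [a o b = lambda_a(b) o rho_b(a)], both of
    which determine their last factor because right groups are left
    cancellative.

    Cancelling [a] in the first one shows that each [lambda_a] is an
    endomorphism of [(B, +)], and cancelling [a o b] shows that
    [a |-> lambda_a] turns [o] into composition ([lambda_circ]).  Since
    idempotents of [(B, o)] act as the identity, the solution [a'] of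
    [a o a' = 0] gives the inverse [lambda_a'] of [lambda_a]: this is left
    non-degeneracy.

    For the Yang-Baxter equation, the second factorization says that [r]
    preserves the product of the two components, so both sides of the
    equation send [(a, b, c)] to triples with product [a o b o c].  By
    cancellation it is enough to compare the first two components.  Both
    first components are [lambda_(a o b)(c)]; and in both triples the product
    of the first two components is [lambda_a(b o c)], which follows from the
    identity [x o lambda_y(c) = x + lambda_(x o y)(c)] and the additivity of
    [lambda_a]. *)

Section LeftRGSemibrace.

Variables (B : Type) (add circ : B -> B -> B) (zero : B).
Hypothesis sbB : is_left_RG_semibrace add circ.
Hypothesis zero_idem : circ zero zero = zero.

Local Notation "x +' y" := (add x y) (at level 50, left associativity).
Local Notation "x *' y" := (circ x y) (at level 40, left associativity).
Local Notation lam := (lambda add circ zero).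
(* The arguments are swapped with respect to [rho]: [rh a b] is rho_b(a). *)
Local Notation rh a b := (rho add circ zero b a).

Let rgA := semibrace_add sbB.
Let rgC := semibrace_circ sbB.
Let addA : associative add := right_group_assoc rgA.
Let circA : associative circ := right_group_assoc rgC.
Let addI a : injective (add a) := @right_group_inj _ _ rgA a.
Let circI a : injective (circ a) := @right_group_inj _ _ rgC a.

Let add_lambda a b : a +' lam a b = a *' b.
Proof. exact: lambdaP. Qed.

(** Left multiplication by [x] only depends on its component [x o 0] in the
    group [B o 0], so the inverse of [h_(lambda_a(b))] in the formula for
    [rho] cancels against [lambda_a(b)] itself. *)
Lemma circ_lambda_rho a b : lam a b *' rh a b = a *' b.
Proof.
have idl := idem_left_id rgC zero_idem.
have Hh : right_translate circ zero (h_elt circ zero (lam a b)).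
  by exists (lam a b).
have [_ hV _] := subgroup_invP rgC zero_idem Hh.
rewrite /rho -[X in lam a b *' X]idl !circA.
by rewrite -/(h_elt circ zero (lam a b)) hV idl.
Qed.

Lemma circ_add a b c : a *' (b +' c) = a *' b +' lam a c.
Proof.
rewrite (semibrace_distr sbB); congr (_ +' _); apply: (addI a).
by rewrite (right_solutionP rgA) add_lambda.
Qed.

Lemma lambda_add a b c : lam a (b +' c) = lam a b +' lam a c.
Proof. by apply: (addI a); rewrite addA !add_lambda circ_add. Qed.

Lemma lambda_circ a b c : lam (a *' b) c = lam a (lam b c).
Proof.
by apply: (addI (a *' b)); rewrite add_lambda -circ_add add_lambda circA.
Qed.

(** An idempotent of [(B, o)] is a valid choice of [0], so it is a left
    identity for both operations. *)
Lemma lambda_idem e : e *' e = e -> lam e =1 id.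
Proof.
move=> ee b; apply: (addI e).
by rewrite add_lambda (idem_left_id rgC ee) (semibrace_add_left_id sbB ee).
Qed.

Lemma lambda_bij a : bijective (lam a).
Proof.
pose a' := right_solution circ a zero.
have aa' : a *' a' = zero by exact: right_solutionP.
exists (lam a') => b; rewrite -lambda_circ; apply: lambda_idem.
- by rewrite circA -(circA a') aa' -circA (idem_left_id rgC zero_idem).
- by rewrite aa'.
Qed.

Lemma circ_lambda x y c : x *' lam y c = x +' lam (x *' y) c.
Proof. by rewrite lambda_circ add_lambda. Qed.

Lemma lambda_braid a b c : lam (lam a b) (lam (rh a b) c) = lam a (lam b c).
Proof. by rewrite -!lambda_circ circ_lambda_rho. Qed.

(** After multiplication by the common first component
    [lambda_a(lambda_b(c))], both sides become [lambda_a(b o c)]. *)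
Lemma rho_lambda_braid a b c :
  rh (lam a b) (lam (rh a b) c) = lam (rh a (lam b c)) (rh b c).
Proof.
apply: (circI (lam a (lam b c))); rewrite -{1}(lambda_braid a b c) circ_lambda_rho.
rewrite !circ_lambda !circ_lambda_rho !lambda_circ -!lambda_add.
by rewrite !add_lambda circ_lambda_rho.
Qed.

(** The first two components of the two triples agree and their products
    are both [a o b o c], so left cancellation identifies the third ones. *)
Lemma rho_braid a b c :
  rh (rh a b) c = rh (rh a (lam b c)) (rh b c).
Proof.
set u := lam a b; set v := rh a b; set p := lam b c; set s := rh b c.
have braid_l : lam a p *' (rh u (lam v c) *' rh v c) = a *' b *' c.
  rewrite -(lambda_braid a b c) circA circ_lambda_rho -circA circ_lambda_rho.
  by rewrite circA circ_lambda_rho.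
have braid_r : lam a p *' (rh a p *' s) = a *' b *' c.
  by rewrite circA circ_lambda_rho -circA circ_lambda_rho circA.
apply: (circI (lam (rh a p) s)); rewrite circ_lambda_rho.
rewrite -(rho_lambda_braid a b c).
by apply: (circI (lam a p)); rewrite braid_l braid_r.
Qed.

End LeftRGSemibrace.

Theorem theorem3p5 (B : Type) (add circ : B -> B -> B) (zero : B)
    (semibrace : is_left_RG_semibrace add circ)
    (zero_idempotent : circ zero zero = zero) :
  is_YBE_solution (r_map add circ zero) /\
  left_nondegenerate (r_map add circ zero).
Proof.
split; last by move=> a; exact: (lambda_bij _ _ _ _ semibrace zero_idempotent).
move=> [[a b] c]; rewrite /r_times_id /id_times_r /r_map /=.
by rewrite lambda_braid // rho_lambda_braid // rho_braid.
Qed.
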